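(* Let $n\ge 1$, let $\Omega$ be a finite subset of $\mathbb{Z}^n$, let $V:\Omega\to[0,\infty)$ be a nonnegative potential and $\rho:\Omega\to(0,\infty)$ a positive density, and let $0<\lambda_1\le\lambda_2\le\cdots\le\lambda_{\sharp\Omega}$ be the eigenvalues, counted with multiplicity, of the weighted Dirichlet Schrödinger problem $$-\Delta u+Vu=\lambda\rho u \ \text{ in } \Omega,\qquad u=0\ \text{ on } \partial\Omega .$$ Put $\rho_{\min}=\min_{\Omega}\rho$ and $\rho_{\max}=\max_{\Omega}\rho$. Then for every integer $k$ with $1\le k\le \sharp\Omega-1$, $$(\lambda_{k+1}-\lambda_k)\left(\frac{\rho_{\min}}{\rho_{\max}}-\frac{\rho_{\min}}{k}\sum_{i=1}^{k}\lambda_i\right)\le\frac{4}{nk}\sum_{i=1}^{k}\lambda_i .$$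
   Context: $\mathbb{Z}^n$ is the integer lattice graph: $x\sim y$ if and only if $\sum_{i=1}^n|x_i-y_i|=1$; every vertex has degree $d_x=2n$. The discrete (normalized) Laplacian is $\Delta f(x)=\frac{1}{d_x}\sum_{y\sim x}(f(y)-f(x))$. The vertex boundary is $\partial\Omega=\{y\in\mathbb{Z}^n\setminus\Omega: y\sim x\text{ for some }x\in\Omega\}$. Functions on $\Omega$ are extended by zero to $\mathbb{Z}^n$, so the eigenvalue problem asks for nonzero $u:\Omega\to\mathbb{R}$, extended by zero, with $-\Delta u(x)+V(x)u(x)=\lambda\rho(x)u(x)$ for all $x\in\Omega$. The operator $(-\Delta+V)/\rho$ with this Dirichlet condition is self-adjoint on $\ell^2(\Omega,\rho)$, with inner product $\langle f,g\rangle=\sum_{x\in\Omega}f(x)g(x)\rho(x)d_x$, and has $\sharp\Omega$ real positive eigenvalues counted with multiplicity. $\sharp\Omega$ denotes the cardinality of $\Omega$. *)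

(* Defs.v *)
From HB Require Import structures.
From mathcomp Require Import all_boot all_order all_algebra.
From mathcomp Require Import finmap.
From mathcomp Require Import all_classical all_reals.
Set Implicit Arguments.
Unset Strict Implicit.
Unset Printing Implicit Defensive.
Import Order.TTheory GRing.Theory Num.Theory.
Local Open Scope fset_scope.
Local Open Scope classical_set_scope.
Local Open Scope ring_scope.

Definition adj n (x y : 'rV[int]_n) : bool :=
  \sum_(i < n) `|x 0 i - y 0 i| == 1.

(* The normalized Laplacian; every vertex of the lattice has degree
   [(2 * n)%N].  The sum ranges over the finite set of neighbours of [x]. *)
Definition laplacian n (R : realType) (f : 'rV[int]_n -> R) (x : 'rV[int]_n) :
    R :=
  (2 * n)%:R^-1 * \sum_(y \in [set y | adj x y]) (f y - f x).

Definition extend0 n (R : realType) (Omega : {fset 'rV[int]_n})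
    (u : Omega -> R) (y : 'rV[int]_n) : R :=
  if insub y is Some x then u x else 0.

(* The equation is required on [Omega] only; the Dirichlet condition on the
   vertex boundary is the extension of [u] by zero. *)
Definition schrodinger_sol n (R : realType) (Omega : {fset 'rV[int]_n})
    (V rho : Omega -> R) (mu : R) (u : Omega -> R) : Prop :=
  forall x : Omega,
    - laplacian (extend0 u) (val x) + V x * u x = mu * rho x * u x.

(* [s] lists, in nondecreasing order, the eigenvalues counted with
   multiplicity: every real [mu] occurs in [s] as many times as the dimension
   of its solution space, which is 0 when [mu] is not an eigenvalue.  [R^o] is
   [R] as a vector space over itself. *)
Definition is_spectrum n (R : realType) (Omega : {fset 'rV[int]_n})
    (V rho : Omega -> R) (s : seq R) : Prop :=
  [/\ size s = #|` Omega|,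
      sorted <=%R s &
      forall mu : R, exists E : {vspace {ffun Omega -> R^o}},
        (forall u, u \in E <-> schrodinger_sol V rho mu u) /\
        \dim E = count_mem mu s].

(* The default value 0 is only taken on an empty domain. *)
Definition min_value (R : realType) (T : finType) (f : T -> R) : R :=
  if [pick x : T] is Some x0 then f [arg min_(x < x0) f x]%O else 0.

Definition max_value (R : realType) (T : finType) (f : T -> R) : R :=
  if [pick x : T] is Some x0 then f [arg max_(x > x0) f x]%O else 0.

(* Main.v *)
Require Import Defs.
From HB Require Import structures.
From mathcomp Require Import all_boot all_order all_algebra.
From mathcomp Require Import finmap.
From mathcomp Require Import all_classical all_reals.
From mathcomp Require Import ring lra zify.
Import Order.TTheory GRing.Theory Num.Theory.
Local Open Scope fset_scope.
Local Open Scope classical_set_scope.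
Local Open Scope ring_scope.

(** This is a Payne-Polya-Weinberger argument: the eigenfunctions multiplied by
    the coordinate functions are the trial functions for the next eigenvalue.

    On functions over Omega, the operator - Delta + V is given by a symmetric
    kernel K.  Let u_i be eigenfunctions with eigenvalue s_i, orthonormal for
    the weight rho, and let c be a coordinate function.  The projection f_i of
    c u_i onto the orthogonal complement of the first k eigenfunctions
    satisfies the Rayleigh bound s_k |f_i|^2 <= (K f_i, f_i), with the
    rho-norm of f_i on the left.  Expanding the right-hand side with the
    commutator D = [c, K]
    leaves
        (s_k - s_i) |f_i|^2 <= - (D u_i, f_i),
    and after summation over i < k, with gap g = s_k - s_(k-1) >= 0, P the sum
    of the |f_i|^2 and W that of the - (D u_i, f_i), it gives g P <= W.  The
    components of f_i along the u_j contribute nothing to W, because their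
    coefficients are symmetric in (i, j) while D is antisymmetric; so W is a
    sum of double commutators.  Since
    g (f, - D u) <= (g^2 |f|^2 + |D u|^2 / rho_min) / 2, one gets
        g W <= (sum over i of |D u_i|^2) / rho_min        (commutator_gap).

    On the lattice, coordinate functions commute with the Laplacian up to
    translations.  If S_a is translation by the a-th unit vector, cut down to
    Omega, and q_a(u) = (S_a u, u), then for the a-th coordinate
        W = (2 n)^-1 (sum over i of q_a(u_i)),    D = (2 n)^-1 (S_a - S_a^T),
    and since S_a is a contraction for the unweighted norm,
        |D u|^2 <= (2 n)^-2 * 8 (|u|^2 - q_a(u))  (shift_commutator_bound).
    The energy identity (schrodinger_energy)
        s_i = |u_i|^2 + (V u_i, u_i) - n^-1 (sum over a of q_a(u_i))
    turns the sum over a of both sides of commutator_gap into quantities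
    controlled by s_i and the squared unweighted norm of u_i, which is at least
    1 / rho_max. *)

(** * Kernels and weighted inner products on a finite set *)

Definition kapp {R : realType} {T : finType} (K : T -> T -> R) (u : T -> R)
    (x : T) : R := \sum_y K x y * u y.

Definition wdot {R : realType} {T : finType} (w u v : T -> R) : R :=
  \sum_x w x * u x * v x.

Lemma wdotC {R : realType} {T : finType} (w u v : T -> R) :
  wdot w u v = wdot w v u.
Proof. by apply: eq_bigr => x _; rewrite mulrAC. Qed.

Lemma wdotZl {R : realType} {T : finType} (w u v : T -> R) (a : R) :
  wdot w (fun x => a * u x) v = a * wdot w u v.
Proof. by rewrite /wdot mulr_sumr; apply: eq_bigr => x _; ring. Qed.

Lemma wdotBl {R : realType} {T : finType} (w u v z : T -> R) :
  wdot w (fun x => u x - v x) z = wdot w u z - wdot w v z.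
Proof. by rewrite /wdot -sumrB; apply: eq_bigr => x _; ring. Qed.

Lemma wdot_suml {R : realType} {T : finType} (w z : T -> R) (I : finType)
    (a : I -> R) (u : I -> T -> R) :
  wdot w (fun x => \sum_i a i * u i x) z = \sum_i a i * wdot w (u i) z.
Proof.
under [RHS]eq_bigr do rewrite mulr_sumr.
rewrite exchange_big; apply: eq_bigr => x _ /=.
by rewrite mulr_sumr mulr_suml; apply: eq_bigr => i _; ring.
Qed.

Lemma wdot_ge0 {R : realType} {T : finType} (w u : T -> R) :
  (forall x, 0 < w x) -> 0 <= wdot w u u.
Proof.
by move=> w0; apply: sumr_ge0 => x _; rewrite -mulrA -expr2 mulr_ge0 ?sqr_ge0 // ltW.
Qed.

Lemma wdot_gt0 {R : realType} {T : finType} (w u : T -> R) (x : T) :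
  (forall x, 0 < w x) -> u x != 0 -> 0 < wdot w u u.
Proof.
move=> w0 ux; rewrite /wdot (bigD1 x) //=.
rewrite ltr_pwDl //; first by rewrite -mulrA -expr2 mulr_gt0 ?exprn_even_gt0.
by apply: sumr_ge0 => y _; rewrite -mulrA -expr2 mulr_ge0 ?sqr_ge0 // ltW.
Qed.

Lemma kappZ {R : realType} {T : finType} (K : T -> T -> R) (u : T -> R) (a : R) x :
  kapp K (fun y => a * u y) x = a * kapp K u x.
Proof. by rewrite /kapp mulr_sumr; apply: eq_bigr => y _; ring. Qed.

Lemma kappB {R : realType} {T : finType} (K : T -> T -> R) (u v : T -> R) x :
  kapp K (fun y => u y - v y) x = kapp K u x - kapp K v x.
Proof. by rewrite /kapp -sumrB; apply: eq_bigr => y _; ring. Qed.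

Lemma kapp_sum {R : realType} {T : finType} (K : T -> T -> R) (I : finType)
    (a : I -> R) (u : I -> T -> R) x :
  kapp K (fun y => \sum_i a i * u i y) x = \sum_i a i * kapp K (u i) x.
Proof.
under [RHS]eq_bigr do rewrite mulr_sumr.
rewrite exchange_big; apply: eq_bigr => y _ /=.
by rewrite mulr_sumr; apply: eq_bigr => i _; ring.
Qed.

Lemma sum_kapp_sym {R : realType} {T : finType} (K : T -> T -> R) (u v : T -> R) :
  (forall x y, K x y = K y x) ->
  \sum_x kapp K u x * v x = \sum_x kapp K v x * u x.
Proof.
move=> Ks; rewrite /kapp.
under eq_bigr do rewrite mulr_suml.
under [RHS]eq_bigr do rewrite mulr_suml.
rewrite exchange_big; apply: eq_bigr => x _; apply: eq_bigr => y _.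
by rewrite Ks; ring.
Qed.

(** * Orthonormal eigenfunctions and the Rayleigh bound *)

Lemma eigen_orthogonal {R : realType} {T : finType} (K : T -> T -> R)
    (rho u v : T -> R) (mu nu : R) :
  (forall x y, K x y = K y x) ->
  (forall x, kapp K u x = mu * rho x * u x) ->
  (forall x, kapp K v x = nu * rho x * v x) ->
  mu != nu -> wdot rho u v = 0.
Proof.
move=> Ks Ku Kv mn; have E : mu * wdot rho u v = nu * wdot rho u v.
  transitivity (\sum_x kapp K u x * v x).
    by rewrite mulr_sumr; apply: eq_bigr => x _; rewrite Ku; ring.
  rewrite sum_kapp_sym // mulr_sumr.
  by apply: eq_bigr => x _; rewrite Kv; ring.
have /eqP : (mu - nu) * wdot rho u v = 0 by rewrite mulrBl E subrr.
by rewrite mulf_eq0 subr_eq0 (negPf mn) => /eqP.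
Qed.

(** In the coordinates of a basis of E, the m orthogonality conditions say that a
    row vector lies in the left kernel of a (dim E) x m matrix, whose rank is
    too small for this kernel to vanish. *)
Lemma exists_orthogonal_in {R : realType} {T : finType} (rho : T -> R) (m : nat)
    (E : {vspace {ffun T -> R^o}}) (f : 'I_m -> T -> R) :
  (m < \dim E)%N ->
  exists u : {ffun T -> R^o},
    [/\ u \in E, u != 0 & forall i, wdot rho u (f i) = 0].
Proof.
move=> mE.
pose B := \matrix_(l < \dim E, i < m) wdot rho ((vbasis E)`_l : {ffun T -> R^o}) (f i).
have : kermx B != 0.
  rewrite kermx_eq0 /row_free; apply/negP => /eqP rB.
  by have := rank_leq_col B; rewrite rB leqNgt mE.
case/rowV0Pn => v /sub_kermxP vB v0.
exists (\sum_(l < \dim E) v 0 l *: (vbasis E)`_l); split.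
- apply: memv_suml => l _; apply: memvZ; apply: vbasis_mem.
  by apply: mem_nth; rewrite size_tuple.
- apply/negP => /eqP v_eq0.
  have /freeP fr := basis_free (vbasisP E).
  move/negP: v0; apply; apply/eqP/rowP => l.
  by rewrite mxE (fr (fun l => v 0 l) v_eq0).
- move=> i; move/matrixP/(_ 0 i): vB; rewrite !mxE => <-.
  transitivity (wdot rho (fun x => \sum_(l < \dim E) v 0 l * ((vbasis E)`_l : {ffun T -> R^o}) x) (f i)).
    apply: eq_bigr => x _; rewrite sum_ffunE; congr (_ * _ * _).
    by apply: eq_bigr => l _; rewrite ffunE.
  by rewrite wdot_suml; apply: eq_bigr => l _; rewrite mxE.
Qed.

(** Induction on the number of functions already chosen.  Only the earlier ones
    with the same eigenvalue constrain the next one, by eigen_orthogonal; they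
    are fewer than the multiplicity, so exists_orthogonal_in applies inside
    the eigenspace. *)
Lemma orthonormal_eigenfamily {R : realType} {T : finType} (K : T -> T -> R)
    (rho : T -> R) (s : seq R) :
  (forall x y, K x y = K y x) -> (forall x, 0 < rho x) ->
  (forall mu : R, exists E : {vspace {ffun T -> R^o}},
      (forall u, u \in E <-> forall x, kapp K u x = mu * rho x * u x) /\
      \dim E = count_mem mu s) ->
  exists u : nat -> T -> R,
    (forall i, (i < size s)%N ->
       forall x, kapp K (u i) x = s`_i * rho x * u i x) /\
    (forall i j, (i < size s)%N -> (j < size s)%N ->
       wdot rho (u i) (u j) = (i == j)%:R).
Proof.
move=> Ks rho0 hs.
suff : forall m, (m <= size s)%N -> exists u : nat -> T -> R,
    (forall i, (i < m)%N -> forall x, kapp K (u i) x = s`_i * rho x * u i x) /\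
    (forall i j, (i < m)%N -> (j < m)%N -> wdot rho (u i) (u j) = (i == j)%:R).
  exact.
elim=> [|m IH] ms; first by exists (fun _ _ => 0).
have [u [Ku ou]] := IH (ltnW ms).
have [E [EP dE]] := hs s`_m.
pose l := [seq i <- iota 0 m | s`_i == s`_m].
have lE : (size l < \dim E)%N.
  have -> : size l = count_mem s`_m (take m s).
    have -> : take m s = [seq s`_i | i <- iota 0 m].
      apply: (@eq_from_nth _ 0); first by rewrite size_map size_iota size_take ms.
      move=> i; rewrite size_take ms => im.
      by rewrite nth_take // (nth_map 0) ?size_iota // nth_iota.
    by rewrite count_map size_filter.
  rewrite dE; have -> : count_mem s`_m s = addn (count_mem s`_m (take m s)) (count_mem s`_m (drop m s)).
    by rewrite -count_cat cat_take_drop.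
  rewrite (drop_nth 0 ms) /= eqxx.
  by rewrite addnCA add1n ltnS leq_addr.
have [v [vE v0 vo]] :=
  exists_orthogonal_in rho (size l) E (fun i => u (nth 0%N l i)) lE.
move/EP: vE => Kv.
(* Equal eigenvalues: by the choice of v; distinct ones: by symmetry of K. *)
have vu i : (i < m)%N -> wdot rho v (u i) = 0.
  move=> im; have [si|si] := eqVneq s`_i s`_m; last first.
    by apply: (eigen_orthogonal K _ _ _ s`_m s`_i) => //; [exact: Ku | rewrite eq_sym].
  have il : i \in l by rewrite mem_filter si eqxx mem_iota.
  have ix : (index i l < size l)%N by rewrite index_mem.
  by have := vo (Ordinal ix); rewrite /= nth_index.
have [x vx] : exists x, v x != 0.
  apply/existsP; apply: contraNT v0; rewrite negb_exists => /forallP v0.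
  by apply/eqP/ffunP => x; rewrite ffunE; apply/eqP; have := v0 x; rewrite negbK.
have N0 : 0 < wdot rho v v by apply: wdot_gt0 vx.
pose c := (Num.sqrt (wdot rho v v))^-1.
have c2 : c * (c * wdot rho v v) = 1.
  rewrite mulrA -expr2 exprVn sqr_sqrtr ?ltW // mulVf // gt_eqF //.
exists (fun i => if i == m then (fun x => c * v x) else u i); split.
  move=> i; rewrite ltnS leq_eqVlt => /orP[/eqP -> y|im y].
    by rewrite eqxx kappZ Kv; ring.
  by rewrite (ltn_eqF im) Ku.
move=> i j; rewrite !ltnS (leq_eqVlt i) (leq_eqVlt j) => /orP[/eqP ->|im] /orP[/eqP ->|jm].
- by rewrite !eqxx wdotZl wdotC wdotZl.
- by rewrite eqxx (ltn_eqF jm) wdotZl vu // mulr0 gtn_eqF.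
- by rewrite eqxx (ltn_eqF im) wdotC wdotZl vu // mulr0.
- by rewrite !(ltn_eqF im, ltn_eqF jm) ou.
Qed.

(** As many orthonormal functions as points form a basis: orthonormality says
    that a square matrix A has a right inverse B, and B A = 1 is the
    expansion of the delta functions. *)
Lemma orthonormal_expansion {R : realType} {T : finType} (rho : T -> R)
    (u : nat -> T -> R) :
  (forall i j, (i < #|T|)%N -> (j < #|T|)%N ->
     wdot rho (u i) (u j) = (i == j)%:R) ->
  forall (f : T -> R) x, f x = \sum_(i < #|T|) wdot rho f (u i) * u i x.
Proof.
move=> ou f x.
pose A := \matrix_(i < #|T|, j < #|T|) (u i (enum_val j) * rho (enum_val j)).
pose B := \matrix_(i < #|T|, j < #|T|) (u j (enum_val i)).
have AB : A *m B = 1%:M.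
  apply/matrixP => i j; rewrite !mxE.
  rewrite -(ou i j (ltn_ord i) (ltn_ord j)) /wdot (reindex _ (onW_bij _ (enum_val_bij T))) /=.
  by apply: eq_bigr => y _; rewrite !mxE; ring.
have /matrixP BA := mulmx1C AB.
rewrite /wdot; under eq_bigr do rewrite mulr_suml.
rewrite exchange_big /= (bigD1 x) //= [X in _ + X]big1 => [|y yx].
  have := BA (enum_rank x) (enum_rank x).
  rewrite !mxE eqxx addr0 => E.
  rewrite -[LHS]mulr1 -[1]E mulr_sumr; apply: eq_bigr => i _.
  by rewrite !mxE !enum_rankK; ring.
have := BA (enum_rank x) (enum_rank y).
rewrite !mxE (inj_eq enum_rank_inj) eq_sym (negPf yx) => E.
rewrite -[RHS](mulr0 (f y)) -[X in _ = _ * X]E mulr_sumr; apply: eq_bigr => i _.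
by rewrite !mxE !enum_rankK; ring.
Qed.

(** In the eigenbasis the two sides are sums of squared coefficients, weighted by
    s_k and by s_i; the coefficients with i < k vanish and s_k <= s_i for the
    others. *)
Lemma rayleigh_ge {R : realType} {T : finType} (K : T -> T -> R)
    (rho : T -> R) (s : seq R) (u : nat -> T -> R) (k : nat) (f : T -> R) :
  size s = #|T| -> sorted <=%R s ->
  (forall i, (i < #|T|)%N -> forall x, kapp K (u i) x = s`_i * rho x * u i x) ->
  (forall i j, (i < #|T|)%N -> (j < #|T|)%N ->
     wdot rho (u i) (u j) = (i == j)%:R) ->
  (forall i, (i < k)%N -> wdot rho f (u i) = 0) ->
  s`_k * wdot rho f f <= \sum_x kapp K f x * f x.
Proof.
move=> sz ss Ku ou fo.
have fE := orthonormal_expansion _ _ ou f.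
have KfE x : kapp K f x = rho x * \sum_(i < #|T|) (wdot rho f (u i) * s`_i) * u i x.
  rewrite (_ : kapp K f x = kapp K (fun y => \sum_(i < #|T|) wdot rho f (u i) * u i y) x).
    by rewrite kapp_sum mulr_sumr; apply: eq_bigr => i _; rewrite Ku //; ring.
  by apply: eq_bigr => y _; rewrite -fE.
have -> : \sum_x kapp K f x * f x = \sum_(i < #|T|) s`_i * wdot rho f (u i) ^+ 2.
  under eq_bigr do rewrite KfE.
  transitivity (wdot rho (fun x => \sum_(i < #|T|) wdot rho f (u i) * s`_i * u i x) f) => //.
  by rewrite wdot_suml; apply: eq_bigr => i _; rewrite (wdotC _ (u i)); ring.
have -> : wdot rho f f = \sum_(i < #|T|) wdot rho f (u i) ^+ 2.
  transitivity (wdot rho (fun x => \sum_(i < #|T|) wdot rho f (u i) * u i x) f).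
    by apply: eq_bigr => x _; rewrite -fE.
  by rewrite wdot_suml; apply: eq_bigr => i _; rewrite (wdotC _ (u i)) expr2.
rewrite mulr_sumr; apply: ler_sum => i _.
have [ik|ki] := ltnP i k; first by rewrite fo // expr0n /= !mulr0.
apply: ler_wpM2r; first exact: sqr_ge0.
have [/ltnW kN|Nk] := ltnP i (size s); last by rewrite sz leqNgt ltn_ord in Nk.
by apply: (sorted_leq_nth le_trans le_refl) => //; rewrite inE sz //; apply: leq_ltn_trans ki _.
Qed.

(** * The commutator inequality *)

(** The kernel of [c, K], with c acting by multiplication. *)
Definition commutator {R : realType} {T : finType} (K : T -> T -> R)
    (c : T -> R) (x y : T) : R := K x y * (c x - c y).

Lemma kapp_commutator {R : realType} {T : finType} (K : T -> T -> R)
    (c u : T -> R) x :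
  kapp K (fun y => c y * u y) x = c x * kapp K u x - kapp (commutator K c) u x.
Proof.
rewrite /kapp mulr_sumr -sumrB; apply: eq_bigr => y _.
by rewrite /commutator; ring.
Qed.

(** Multiplication by c and K are both symmetric, hence their commutator is
    antisymmetric. *)
Lemma commutator_antisym {R : realType} {T : finType} (K : T -> T -> R)
    (c u v : T -> R) :
  (forall x y, K x y = K y x) ->
  \sum_x kapp (commutator K c) u x * v x
    = - \sum_x kapp (commutator K c) v x * u x.
Proof.
move=> Ks; rewrite /kapp -sumrN.
under eq_bigr do rewrite mulr_suml.
under [RHS]eq_bigr do rewrite mulr_suml -sumrN.
rewrite exchange_big; apply: eq_bigr => x _; apply: eq_bigr => y _.
by rewrite /commutator Ks; ring.
Qed.

(** Averaging the sum with the one where x and y are exchanged completes the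
    square in c; the right-hand side is the form of the double commutator
    [c, [c, K]], whose kernel is K x y * (c x - c y) ^+ 2. *)
Lemma double_commutator {R : realType} {T : finType} (K : T -> T -> R)
    (c u : T -> R) :
  (forall x y, K x y = K y x) ->
  2 * \sum_x kapp (commutator K c) u x * (c x * u x)
    = \sum_x \sum_y K x y * (c x - c y) ^+ 2 * u x * u y.
Proof.
move=> Ks.
have E : \sum_x kapp (commutator K c) u x * (c x * u x) =
    \sum_x \sum_y K x y * (c x - c y) * c x * u x * u y.
  by apply: eq_bigr => x _; rewrite mulr_suml; apply: eq_bigr => y _; rewrite /commutator; ring.
have E' : \sum_x kapp (commutator K c) u x * (c x * u x) =
    \sum_x \sum_y K x y * (c y - c x) * c y * u x * u y.
  by rewrite E exchange_big; apply: eq_bigr => x _; apply: eq_bigr => y _; rewrite Ks; ring.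
rewrite mulr_natl mulr2n {1}E E' -big_split; apply: eq_bigr => x _ /=.
by rewrite -big_split; apply: eq_bigr => y _ /=; ring.
Qed.

(** The core of the argument: the functions f i below are tested in the Rayleigh
    bound.  Factors 2 are kept on both sides so that the left-hand sum is
    the one of double_commutator up to sign. *)
Lemma commutator_gap {R : realType} {T : finType} (K : T -> T -> R)
    (rho c : T -> R) (s : seq R) (u : nat -> T -> R) (k : nat) (r : R) :
  (forall x y, K x y = K y x) ->
  size s = #|T| -> sorted <=%R s ->
  (forall i, (i < #|T|)%N -> forall x, kapp K (u i) x = s`_i * rho x * u i x) ->
  (forall i j, (i < #|T|)%N -> (j < #|T|)%N ->
     wdot rho (u i) (u j) = (i == j)%:R) ->
  (0 < k < #|T|)%N -> 0 < r -> (forall x, r <= rho x) ->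
  (s`_k - s`_(k - 1)) *
    (\sum_(i < k) - (\sum_x \sum_y K x y * (c x - c y) ^+ 2 * u i x * u i y))
  <= 2 / r * \sum_(i < k) \sum_x kapp (commutator K c) (u i) x ^+ 2.
Proof.
move=> Ks sz ss Ku ou /andP[k0 kT] r0 rrho.
pose D := kapp (commutator K c).
pose a i j := wdot rho (fun x => c x * u i x) (u j).
pose f i x := c x * u i x - \sum_(j < k) a i j * u j x.
have rho0 x : 0 < rho x by apply: lt_le_trans (rrho x).
have aC i j : a i j = a j i by apply: eq_bigr => x _ /=; ring.
(* f i is the part of c * u i orthogonal to the first k eigenfunctions. *)
have fo (i : 'I_k) j : (j < k)%N -> wdot rho (f i) (u j) = 0.
  move=> jk; rewrite /f wdotBl wdot_suml.
  rewrite (bigD1 (Ordinal jk)) //= ou ?(ltn_trans jk) // eqxx big1 => [|l lj].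
    by rewrite /a /= mulr1 addr0 subrr.
  by rewrite ou ?(ltn_trans (ltn_ord l)) ?(ltn_trans jk) // (negPf lj : (l == j :> nat) = false) mulr0.
have Kf (i : 'I_k) x : kapp K (f i) x =
    rho x * (s`_i * (c x * u i x) - \sum_(j < k) a i j * s`_j * u j x) - D (u i) x.
  rewrite /f kappB kapp_commutator kapp_sum Ku ?(ltn_trans (ltn_ord i)) //.
  rewrite -/(D _ _).
  have -> : \sum_(j < k) a i j * kapp K (u j) x = rho x * \sum_(j < k) a i j * s`_j * u j x.
    rewrite mulr_sumr; apply: eq_bigr => j _.
    by rewrite Ku ?(ltn_trans (ltn_ord j)) //; ring.
  by ring.
have proj (b : 'I_k -> R) (i : 'I_k) :
    wdot rho (fun x => \sum_(j < k) b j * u j x) (f i) = 0.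
  by rewrite wdot_suml big1 // => j _; rewrite wdotC fo ?mulr0.
have step (i : 'I_k) :
    (s`_k - s`_i) * wdot rho (f i) (f i) <= - \sum_x D (u i) x * f i x.
  have ik := fo i; have := rayleigh_ge K rho s u k (f i) sz ss Ku ou ik.
  have cf : wdot rho (fun x => c x * u i x) (f i) = wdot rho (f i) (f i).
    by rewrite [RHS]wdotBl proj subr0.
  have -> : \sum_x kapp K (f i) x * f i x =
      s`_i * wdot rho (f i) (f i) - \sum_x D (u i) x * f i x.
    rewrite -[X in s`_i * X]cf -wdotZl.
    have E := proj (fun j => a i j * s`_j) i.
    transitivity (wdot rho (fun x => s`_i * (c x * u i x)) (f i) -
        wdot rho (fun x => \sum_(j < k) a i j * s`_j * u j x) (f i) -
        \sum_x D (u i) x * f i x); last by rewrite E subr0.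
    rewrite -wdotBl /wdot -sumrB; apply: eq_bigr => x _.
    by rewrite Kf mulrBl.
  by lra.
pose P := \sum_(i < k) wdot rho (f i) (f i).
pose W := \sum_(i < k) - \sum_x D (u i) x * f i x.
pose Q := \sum_(i < k) \sum_x D (u i) x ^+ 2.
pose g := s`_k - s`_(k - 1).
have ks : (k < size s)%N by rewrite sz.
have smono i j : (i <= j)%N -> (j <= k)%N -> s`_i <= s`_j.
  move=> ij jk; apply: (sorted_leq_nth le_trans le_refl) => //; rewrite inE.
    by apply: leq_ltn_trans ks; apply: leq_trans jk.
  exact: leq_ltn_trans ks.
have g0 : 0 <= g by rewrite subr_ge0 smono // leq_subr.
have gP : g * P <= W.
  rewrite /P mulr_sumr; apply: ler_sum => i _; apply: le_trans (step i).
  apply: ler_wpM2r; first exact: wdot_ge0.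
  by rewrite lerD2l lerN2 smono ?leq_subr // subn1 -ltnS prednK.
have WE : 2 * W = \sum_(i < k) - (\sum_x \sum_y K x y * (c x - c y) ^+ 2 * u i x * u i y).
  pose B i j := \sum_x D (u i) x * u j x.
  have -> : W = \sum_(i < k) - \sum_x D (u i) x * (c x * u i x) +
                \sum_(i < k) \sum_(j < k) a i j * B i j.
    rewrite -big_split; apply: eq_bigr => i _ /=.
    under [X in _ = _ + X]eq_bigr do rewrite mulr_sumr.
    rewrite exchange_big -sumrN -sumrN -big_split; apply: eq_bigr => x _ /=.
    rewrite /f mulrBr opprB addrC mulr_sumr; congr (_ + _).
    by apply: eq_bigr => j _; ring.
  (* a is symmetric and B antisymmetric in (i, j). *)
  have B0 : \sum_(i < k) \sum_(j < k) a i j * B i j = 0.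
    set S := LHS; suff : S = - S by lra.
    rewrite {1}/S exchange_big -sumrN; apply: eq_bigr => i _.
    rewrite -sumrN; apply: eq_bigr => j _.
    by rewrite aC /B [X in _ * X]commutator_antisym // mulrN.
  rewrite B0 addr0 mulr_sumr; apply: eq_bigr => i _.
  by rewrite mulrN double_commutator.
(* Cauchy-Schwarz in the form of a nonnegative square, with the multiplier g
   chosen so that g P <= W can absorb the quadratic term. *)
have main : 0 <= g ^+ 2 * P - 2 * (g * W) + r^-1 * Q.
  rewrite /P /W /Q !mulr_sumr -sumrN -!big_split.
  apply: sumr_ge0 => i _ /=; rewrite /wdot !(mulr_sumr, mulrN) -!sumrN -!big_split.
  apply: sumr_ge0 => x _ /=.
  have : 0 <= (g * rho x * f i x + D (u i) x) ^+ 2 / rho x.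
    by rewrite divr_ge0 ?sqr_ge0 // ltW.
  have ir : (rho x)^-1 <= r^-1 by rewrite lef_pV2 ?posrE.
  have := ler_wpM2r (sqr_ge0 (D (u i) x)) ir.
  have -> : (g * rho x * f i x + D (u i) x) ^+ 2 / rho x =
    g ^+ 2 * (rho x * f i x * f i x) + 2 * g * (D (u i) x * f i x) + (rho x)^-1 * D (u i) x ^+ 2.
    by field; rewrite gt_eqF.
  by lra.
rewrite -WE -/g -/Q.
have := ler_wpM2l g0 gP.
by rewrite expr2 in main; lra.
Qed.

(** * Neighbours in the lattice *)

(** Neighbours are indexed by pairs (direction, orientation), which makes sums
    over a neighbourhood sums over a finite type. *)
Definition signed_unit {n : nat} (p : 'I_n * bool) : 'rV[int]_n :=
  if p.2 then delta_mx 0 p.1 else - delta_mx 0 p.1.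

Lemma signed_unit_inj {n : nat} : injective (@signed_unit n).
Proof.
move=> [a b] [a' b'] /rowP E.
have := E a; have := E a'.
by case: b b' {E} => [] [] /=; rewrite /signed_unit /= !mxE !eqxx /= eq_sym; have [->|] := eqVneq a a'; rewrite ?eqxx //.
Qed.

(** Integers whose absolute values add up to 1 are all zero but one, which is a
    sign. *)
Lemma adjP {n : nat} (x y : 'rV[int]_n) :
  reflect (exists p, y = x + signed_unit p) (adj x y).
Proof.
apply: (iffP idP) => [/eqP sum1|[[a b] ->]]; last first.
  rewrite /adj (bigD1 a) //= big1 => [|i ia].
    by rewrite /signed_unit; case: b; rewrite !mxE !eqxx addr0 /= opprD addNKr ?opprK ?normrN normr1.
  by rewrite /signed_unit; case: b; rewrite !mxE (negPf ia) andbF ?oppr0 addr0 subrr normr0.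
have [a za] : exists a, x 0 a - y 0 a != 0.
  apply/existsP; move/eqP: sum1; apply: contraLR; rewrite negb_exists => /forallP z0.
  by rewrite big1 // => i _; have := z0 i; rewrite negbK => /eqP ->; rewrite normr0.
rewrite (bigD1 a) //= in sum1.
have rest0 : 0 <= \sum_(i < n | i != a) `|x 0 i - y 0 i| by apply: sumr_ge0.
have rest : \sum_(i < n | i != a) `|x 0 i - y 0 i| = 0.
  by move: za sum1 rest0; set S := \sum_(_ < _ | _) _; lia.
have others i : i != a -> y 0 i = x 0 i.
  move=> ia; have /(_ i ia) := psumr_eq0P (fun i _ => normr_ge0 _) rest.
  by move/normr0_eq0/eqP; rewrite subr_eq0 => /eqP ->.
rewrite rest addr0 in sum1.
exists (a, x 0 a < y 0 a); apply/rowP => i; rewrite /signed_unit /=.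
have [->|ia] := eqVneq i a; last first.
  by case: ifP => _; rewrite !mxE (negPf ia) andbF ?oppr0 addr0 others.
by case: ifP; rewrite !mxE !eqxx /=; lia.
Qed.

Lemma sum_neighbours {n : nat} {R : realType} (x : 'rV[int]_n)
    (F : 'rV[int]_n -> R) :
  \sum_(y \in [set y | adj x y]) F y = \sum_p F (x + signed_unit p).
Proof.
pose r := [seq x + signed_unit p | p <- enum {: 'I_n * bool}].
have -> : [set y | adj x y] = [set` r].
  apply/seteqP; split=> y /=.
    by move/adjP => [p ->]; apply: map_f; rewrite mem_enum.
  by move/mapP => [p _ ->]; apply/adjP; exists p.
rewrite -fsbig_seq; first by rewrite big_map big_enum.
rewrite map_inj_uniq ?enum_uniq // => p q /addrI; exact: signed_unit_inj.
Qed.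

Lemma adj_sum {n : nat} {R : realType} (x y : 'rV[int]_n) :
  (adj x y)%:R = \sum_p (y == x + signed_unit p)%:R :> R.
Proof.
have [[p ->]|/adjP nadj] := adjP x y.
  rewrite (bigD1 p) //= eqxx big1 ?addr0 // => q qp.
  by rewrite (inj_eq (addrI _)) (inj_eq signed_unit_inj) eq_sym (negPf qp).
rewrite big1 // => p _; apply/eqP; rewrite pnatr_eq0 eqb0.
by apply: contra nadj => /eqP ->; apply/adjP; exists p.
Qed.

Lemma sum_signed_units {n : nat} {R : realType} (F : 'rV[int]_n -> R) :
  \sum_(p : 'I_n * bool) F (signed_unit p)
    = \sum_(a < n) (F (delta_mx 0 a) + F (- delta_mx 0 a)).
Proof.
transitivity (\sum_(a < n) \sum_(b : bool) F (signed_unit (a, b))).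
  by rewrite pair_big /=; apply: eq_bigr => -[].
by apply: eq_bigr => a _; rewrite big_bool.
Qed.

Lemma extend0E {n : nat} {R : realType} (Omega : {fset 'rV[int]_n})
    (u : Omega -> R) (z : 'rV[int]_n) :
  extend0 u z = \sum_(y : Omega) (val y == z)%:R * u y.
Proof.
rewrite /extend0; case: insubP => [y zO <-|zO].
  rewrite (bigD1 y) //= eqxx mul1r big1 ?addr0 // => y' yy'.
  by rewrite (inj_eq val_inj) (negPf yy') mul0r.
rewrite big1 // => y _; case: eqP => [yz|_]; last by rewrite mul0r.
by rewrite -yz (valP y) in zO.
Qed.

(** * The Schrodinger operator as a symmetric kernel *)

Definition schrodinger_kernel {n : nat} {R : realType}
    {Omega : {fset 'rV[int]_n}} (V : Omega -> R) (x y : Omega) : R :=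
  (x == y)%:R * (1 + V x) - (2 * n)%:R^-1 * (adj (val x) (val y))%:R.

(** Every vertex has 2n neighbours, so the terms f x of - Delta add up to
    the identity; extension by zero restricts the remaining sum to Omega. *)
Lemma schrodinger_kernelE {n : nat} {R : realType}
    {Omega : {fset 'rV[int]_n}} (V u : Omega -> R) (x : Omega) :
  (0 < n)%N ->
  - laplacian (extend0 u) (val x) + V x * u x = kapp (schrodinger_kernel V) u x.
Proof.
move=> n0; have n2 : (2 * n)%:R != 0 :> R by rewrite pnatr_eq0; lia.
have ux : extend0 u (val x) = u x.
  rewrite extend0E (bigD1 x) //= eqxx mul1r big1 ?addr0 // => y yx.
  by rewrite (inj_eq val_inj) (negPf yx) mul0r.
have -> : laplacian (extend0 u) (val x) =
    (2 * n)%:R^-1 * (\sum_(y : Omega) (adj (val x) (val y))%:R * u y) - u x.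
  rewrite /laplacian sum_neighbours sumrB sumr_const card_prod card_ord card_bool ux.
  rewrite mulrBr -(mulr_natl (u x)) (mulnC n) mulKf //; congr (_ * _ - _).
  under eq_bigr do rewrite extend0E.
  rewrite exchange_big; apply: eq_bigr => y _ /=.
  by rewrite adj_sum mulr_suml.
rewrite /kapp /schrodinger_kernel.
under [RHS]eq_bigr do rewrite mulrBl.
rewrite sumrB [X in _ = X - _](bigD1 x) //= eqxx [X in _ = _ + X - _]big1 => [|y yx]; last by rewrite eq_sym (negPf yx) !mul0r.
rewrite mulr_sumr; under [X in _ = _ - X]eq_bigr do rewrite -mulrA.
by rewrite mul1r; ring.
Qed.

(** * Translations and coordinate functions *)

Definition shift {n : nat} (R : realType) {Omega : {fset 'rV[int]_n}}
    (a : 'I_n) (x y : Omega) : R := (val y == val x + delta_mx 0 a)%:R.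

Definition coordinate {n : nat} (R : realType) {Omega : {fset 'rV[int]_n}}
    (a : 'I_n) (x : Omega) : R := (val x 0 a)%:~R.

Lemma adj_shift {n : nat} (R : realType) {Omega : {fset 'rV[int]_n}}
    (x y : Omega) :
  (adj (val x) (val y))%:R = \sum_(a < n) (shift R a x y + shift R a y x).
Proof.
rewrite adj_sum (sum_signed_units (fun z => (val y == val x + z)%:R)).
by apply: eq_bigr => a _; congr (_ + (nat_of_bool _)%:R); rewrite eq_sym subr_eq.
Qed.

Lemma shift_coordinate {n : nat} (R : realType) {Omega : {fset 'rV[int]_n}}
    (a : 'I_n) (x y : Omega) :
  shift R a x y * coordinate R a y = shift R a x y * (coordinate R a x + 1).
Proof.
rewrite /shift /coordinate; case: eqP => [->|_]; last by rewrite !mul0r.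
by rewrite !mxE !eqxx rmorphD.
Qed.

Lemma shift_coordinate_neq {n : nat} (R : realType)
    {Omega : {fset 'rV[int]_n}} (a b : 'I_n) (x y : Omega) :
  a != b ->
  shift R b x y * coordinate R a y = shift R b x y * coordinate R a x.
Proof.
move=> ab; rewrite /shift /coordinate; case: eqP => [->|_]; last by rewrite !mul0r.
by rewrite !mxE (negPf ab) andbF addr0.
Qed.

(** Only edges in direction a change the a-th coordinate, and they change it by
    one, so the commutator is a difference of opposite translations. *)
Lemma kernel_coordinate {n : nat} {R : realType} {Omega : {fset 'rV[int]_n}}
    (V : Omega -> R) (a : 'I_n) (x y : Omega) :
  commutator (schrodinger_kernel V) (coordinate R a) x y
    = (2 * n)%:R^-1 * (shift R a x y - shift R a y x).
Proof.
rewrite /commutator /schrodinger_kernel mulrBl -!mulrA.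
have -> : (x == y)%:R * ((1 + V x) * (coordinate R a x - coordinate R a y)) = 0.
  by case: eqP => [->|_]; rewrite ?subrr ?mulr0 ?mul0r.
rewrite sub0r -mulrN; congr (_ * _).
rewrite adj_shift mulr_suml -sumrN (bigD1 a) //= big1 => [|b ba].
  have := shift_coordinate R a x y; have := shift_coordinate R a y x.
  by lra.
rewrite eq_sym in ba; have := shift_coordinate_neq R a b x y ba.
by have := shift_coordinate_neq R a b y x ba; lra.
Qed.

Lemma kernel_coordinate2 {n : nat} {R : realType} {Omega : {fset 'rV[int]_n}}
    (V : Omega -> R) (a : 'I_n) (x y : Omega) :
  schrodinger_kernel V x y * (coordinate R a x - coordinate R a y) ^+ 2
    = - ((2 * n)%:R^-1 * (shift R a x y + shift R a y x)).
Proof.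
rewrite expr2 mulrA -/(commutator (schrodinger_kernel V) (coordinate R a) x y).
rewrite kernel_coordinate -mulrA -mulrN; congr (_ * _).
have := shift_coordinate R a x y; have := shift_coordinate R a y x.
by lra.
Qed.

(** Each row of a partial injection has at most one entry, so squaring commutes
    with the row sums; each column also has at most one, so no square is
    counted twice. *)
Lemma partial_injection_contracts {R : realType} {T : finType} (m : rel T)
    (u : T -> R) :
  (forall x y y', m x y -> m x y' -> y = y') ->
  (forall x x' y, m x y -> m x' y -> x = x') ->
  \sum_x (kapp (fun x y => (m x y)%:R) u x) ^+ 2 <= \sum_x u x ^+ 2.
Proof.
move=> fm im.
have sqE x : (kapp (fun x y => (m x y)%:R) u x) ^+ 2 = \sum_y (m x y)%:R * u y ^+ 2.
  rewrite /kapp; case: (pickP (m x)) => [y mxy|none].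
    have other z : z != y -> (m x z)%:R = 0 :> R.
      by move=> zy; case: (boolP (m x z)) => // /(fm _ _ _ mxy) E; rewrite E eqxx in zy.
    rewrite (bigD1 y) //= [in RHS](bigD1 y) //= !big1 => [|z zy|z zy]; try by rewrite other ?mul0r.
    by rewrite mxy !mul1r !addr0.
  by rewrite !big1 ?expr0n // => y _; rewrite none mul0r.
under eq_bigr do rewrite sqE.
rewrite exchange_big; apply: ler_sum => y _ /=; rewrite -mulr_suml.
rewrite ler_piMl ?sqr_ge0 //.
case: (pickP (m^~ y)) => [x mxy|none]; last by rewrite big1 // => x _; rewrite none.
rewrite (bigD1 x) //= mxy big1 ?addr0 // => z zx.
by case: (boolP (m z y)) => // /(im _ _ _ mxy) E; rewrite E eqxx in zx.
Qed.

(** The form (S u, u) of the translation S in direction a. *)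
Definition correlation {n : nat} {R : realType} {Omega : {fset 'rV[int]_n}}
    (a : 'I_n) (u : Omega -> R) : R := \sum_x \sum_y shift R a x y * u x * u y.

Lemma correlation_sym {n : nat} {R : realType} {Omega : {fset 'rV[int]_n}}
    (a : 'I_n) (u : Omega -> R) :
  \sum_x \sum_y (shift R a x y + shift R a y x) * u x * u y
    = 2 * correlation a u.
Proof.
rewrite mulr_natl mulr2n {2}/correlation [X in _ = _ + X]exchange_big.
rewrite -big_split; apply: eq_bigr => x _ /=.
by rewrite -big_split; apply: eq_bigr => y _ /=; ring.
Qed.

Lemma double_commutator_correlation {n : nat} {R : realType}
    {Omega : {fset 'rV[int]_n}} (V : Omega -> R) (a : 'I_n) (u : Omega -> R) :
  (0 < n)%N ->
  - (\sum_x \sum_y schrodinger_kernel V x y *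
       (coordinate R a x - coordinate R a y) ^+ 2 * u x * u y)
    = n%:R^-1 * correlation a u.
Proof.
move=> n0; transitivity ((2 * n)%:R^-1 * (2 * correlation a u)); last first.
  by rewrite natrM; field; rewrite pnatr_eq0 -lt0n.
rewrite -correlation_sym mulr_sumr -sumrN; apply: eq_bigr => x _.
rewrite mulr_sumr -sumrN; apply: eq_bigr => y _.
by rewrite kernel_coordinate2; ring.
Qed.

(** With S the translation and S' its transpose,
    (S - S')^2 <= 2 (S - 1)^2 + 2 (S' - 1)^2 pointwise, and both translations
    contract while having the same form as correlation. *)
Lemma shift_commutator_bound {n : nat} {R : realType}
    {Omega : {fset 'rV[int]_n}} (V : Omega -> R) (a : 'I_n) (u : Omega -> R) :
  \sum_x kapp (commutator (schrodinger_kernel V) (coordinate R a)) u x ^+ 2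
  <= (2 * n)%:R^-1 ^+ 2 * (8 * (\sum_x u x ^+ 2 - correlation a u)).
Proof.
pose S := kapp (shift R a) u; pose S' := kapp (fun x y => shift R a y x) u.
have SS : \sum_x S x ^+ 2 <= \sum_x u x ^+ 2.
  apply: partial_injection_contracts => [x y y' /eqP E /eqP E'|x x' y /eqP -> /eqP E].
    by apply: val_inj; rewrite E E'.
  by apply: val_inj; apply: addIr E.
have SS' : \sum_x S' x ^+ 2 <= \sum_x u x ^+ 2.
  apply: (partial_injection_contracts (fun x y => val x == val y + delta_mx 0 a)).
    by move=> x y y' /eqP -> /eqP E; apply: val_inj; apply: addIr E.
  by move=> x x' y /eqP E /eqP E'; apply: val_inj; rewrite E E'.
have Su : \sum_x S x * u x = correlation a u.
  by apply: eq_bigr => x _; rewrite mulr_suml; apply: eq_bigr => y _; ring.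
have S'u : \sum_x S' x * u x = correlation a u.
  rewrite /correlation exchange_big; apply: eq_bigr => x _ /=.
  by rewrite mulr_suml; apply: eq_bigr => y _; ring.
have comE x : kapp (commutator (schrodinger_kernel V) (coordinate R a)) u x =
    (2 * n)%:R^-1 * (S x - S' x).
  rewrite /S /S' /kapp -sumrB mulr_sumr; apply: eq_bigr => y _.
  by rewrite kernel_coordinate; ring.
under eq_bigr do rewrite comE exprMn.
rewrite -mulr_sumr; apply: ler_wpM2l; first exact: sqr_ge0.
apply: (@le_trans _ _ (2 * \sum_x S x ^+ 2 + 2 * \sum_x S' x ^+ 2 +
  4 * \sum_x u x ^+ 2 - 4 * \sum_x S x * u x - 4 * \sum_x S' x * u x)); last first.
  by rewrite Su S'u; lra.
rewrite !mulr_sumr -!big_split -!sumrB; apply: ler_sum => x _ /=.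
by have := sqr_ge0 (S x + S' x - 2 * u x); lra.
Qed.

(** Each direction contributes its correlation twice, once for each orientation
    of its edges. *)
Lemma schrodinger_energy {n : nat} {R : realType}
    {Omega : {fset 'rV[int]_n}} (V u : Omega -> R) : (0 < n)%N ->
  \sum_x kapp (schrodinger_kernel V) u x * u x
  = \sum_x (1 + V x) * u x ^+ 2 - n%:R^-1 * \sum_(a < n) correlation a u.
Proof.
move=> n0.
have kE x : kapp (schrodinger_kernel V) u x * u x = (1 + V x) * u x ^+ 2 -
    (2 * n)%:R^-1 * \sum_y (adj (val x) (val y))%:R * u x * u y.
  rewrite /kapp /schrodinger_kernel.
  under eq_bigr do rewrite mulrBl.
  rewrite sumrB (bigD1 x) //= eqxx big1 => [|y yx]; last by rewrite eq_sym (negPf yx) !mul0r.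
  rewrite mulrBl mulr_sumr mulr_suml addr0; congr (_ - _); first by rewrite mul1r; ring.
  by apply: eq_bigr => y _; ring.
under eq_bigr do rewrite kE.
rewrite sumrB -mulr_sumr; congr (_ - _).
have -> : \sum_x \sum_y (adj (val x) (val y))%:R * u x * u y
    = 2 * \sum_(a < n) correlation a u.
  transitivity (\sum_(a < n) \sum_x \sum_y (shift R a x y + shift R a y x) * u x * u y).
    rewrite [RHS]exchange_big; apply: eq_bigr => x _ /=.
    rewrite [RHS]exchange_big; apply: eq_bigr => y _ /=.
    by rewrite adj_shift !mulr_suml.
  rewrite mulr_sumr; apply: eq_bigr => a _.
  exact: correlation_sym.
by rewrite natrM; field; rewrite pnatr_eq0 -lt0n.
Qed.

(** * The eigenvalue inequality *)

Lemma min_value_le {R : realType} {T : finType} (f : T -> R) (x : T) :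
  min_value f <= f x.
Proof.
rewrite /min_value; case: pickP => [x0 _|none]; last by have := none x.
by case: arg_minP => // i _; apply.
Qed.

Lemma le_max_value {R : realType} {T : finType} (f : T -> R) (x : T) :
  f x <= max_value f.
Proof.
rewrite /max_value; case: pickP => [x0 _|none]; last by have := none x.
by case: arg_maxP => // i _; apply.
Qed.

Lemma min_value_gt0 {R : realType} {T : finType} (f : T -> R) (x : T) :
  (forall y, 0 < f y) -> 0 < min_value f.
Proof.
by move=> f0; rewrite /min_value; case: pickP => [x0 _|none] //; have := none x.
Qed.

(* The list [s] is indexed from 0: [s`_i] is the (i+1)-st eigenvalue. *)
Theorem theorem1p4 (R : realType) (n : nat) (hn : (1 <= n)%N)
    (Omega : {fset 'rV[int]_n}) (V rho : Omega -> R)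
    (hV : forall x : Omega, 0 <= V x) (hrho : forall x : Omega, 0 < rho x)
    (s : seq R) (hs : is_spectrum V rho s)
    (k : nat) (hk1 : (1 <= k)%N) (hk2 : (k <= #|` Omega| - 1)%N) :
  (s`_k - s`_(k - 1)) *
    (min_value rho / max_value rho
       - min_value rho / k%:R * \sum_(i < k) s`_i)
  <= 4 / (n * k)%:R * \sum_(i < k) s`_i.
Proof.
case: hs => sz ss spec; rewrite cardfE in sz hk2.
have kT : (k < #|{: Omega}|)%N by move: hk1 hk2; set N := #|_|; lia.
pose K := schrodinger_kernel V.
have Ks x y : K x y = K y x.
  rewrite /K /schrodinger_kernel (adj_shift R x y) (adj_shift R y x).
  have [-> //|xy] := eqVneq x y; rewrite !mul0r; congr (_ - _ * _).
  by apply: eq_bigr => a _; rewrite addrC.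
have [|u [Ku ou]] := orthonormal_eigenfamily K rho s Ks hrho.
  move=> mu; have [E [EP dE]] := spec mu; exists E; split => // v.
  by split=> [/EP H x|H]; [|apply/EP => x]; have := H x; rewrite schrodinger_kernelE.
rewrite sz in Ku ou.
have [x0 _] : exists x : Omega, true.
  by have /card_gt0P [x _] : (0 < #|{: Omega}|)%N by exact: leq_ltn_trans kT; exists x.
pose rmin := min_value rho; pose rmax := max_value rho.
have rmin0 : 0 < rmin by apply: min_value_gt0.
have rmax0 : 0 < rmax by apply: lt_le_trans (le_max_value rho x0).
pose g := s`_k - s`_(k - 1).
have g0 : 0 <= g.
  rewrite subr_ge0; apply: (sorted_leq_nth le_trans le_refl) => //;
    rewrite ?inE ?sz ?leq_subr //.
  by apply: leq_ltn_trans kT; rewrite leq_subr.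
pose A (i : 'I_k) := \sum_x u i x ^+ 2.
pose C (i : 'I_k) := \sum_(a < n) correlation a (u i).
pose L := \sum_(i < k) s`_i.
have nu : n%:R != 0 :> R by rewrite pnatr_eq0 -lt0n.
have n0 : 0 < n%:R :> R by rewrite ltr0n.
have k0 : 0 < k%:R :> R by rewrite ltr0n.
have norm1 (i : 'I_k) : \sum_x rho x * u i x * u i x = 1.
  by rewrite -[LHS]/(wdot rho (u i) (u i)) ou ?eqxx //; apply: ltn_trans kT.
have energy (i : 'I_k) :
    s`_i = A i + \sum_x V x * u i x ^+ 2 - n%:R^-1 * C i.
  transitivity (\sum_x kapp K (u i) x * u i x).
    rewrite -[LHS]mulr1 -(norm1 i) mulr_sumr; apply: eq_bigr => x _.
    by rewrite Ku ?(ltn_trans (ltn_ord i)) //; ring.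
  rewrite schrodinger_energy //; congr (_ - _).
  by rewrite -big_split; apply: eq_bigr => x _ /=; ring.
have V0 (i : 'I_k) : 0 <= \sum_x V x * u i x ^+ 2.
  by apply: sumr_ge0 => x _; rewrite mulr_ge0 ?sqr_ge0.
have A1 (i : 'I_k) : rmax^-1 <= A i.
  rewrite -[leLHS]mulr1 ler_pdivrMl // -(norm1 i) mulr_sumr.
  apply: ler_sum => x _; rewrite -mulrA -expr2.
  by rewrite ler_wpM2r ?sqr_ge0 ?le_max_value.
(* The commutator inequality for the a-th coordinate. *)
have gap (a : 'I_n) : g * (n%:R^-1 * \sum_(i < k) correlation a (u i)) <=
    4 / (rmin * n%:R ^+ 2) * \sum_(i < k) (A i - correlation a (u i)).
  have kk : (0 < k < #|{: Omega}|)%N by rewrite hk1.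
  have := commutator_gap K rho (coordinate R a) s u k rmin Ks sz ss Ku ou kk rmin0
    (min_value_le rho).
  rewrite -/g (_ : \sum_(i < k) - _ = n%:R^-1 * \sum_(i < k) correlation a (u i)); last first.
    rewrite mulr_sumr; apply: eq_bigr => i _.
    exact: double_commutator_correlation.
  move/le_trans; apply.
  apply: (@le_trans _ _ (2 / rmin * \sum_(i < k)
      (2 * n)%:R^-1 ^+ 2 * (8 * (A i - correlation a (u i))))).
    apply: ler_wpM2l; first by rewrite divr_ge0 // ltW.
    by apply: ler_sum => i _; apply: shift_commutator_bound.
  rewrite -!mulr_sumr natrM le_eqVlt; apply/orP; left; apply/eqP.
  by field; rewrite nu gt_eqF.
have gapsum : g * \sum_(i < k) (n%:R^-1 * C i) <=
    4 / (rmin * n%:R) * \sum_(i < k) (A i - n%:R^-1 * C i).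
  have -> : \sum_(i < k) (n%:R^-1 * C i) =
      \sum_(a < n) n%:R^-1 * \sum_(i < k) correlation a (u i).
    by rewrite -!mulr_sumr exchange_big.
  have -> : 4 / (rmin * n%:R) * \sum_(i < k) (A i - n%:R^-1 * C i) =
      \sum_(a < n) 4 / (rmin * n%:R ^+ 2) * \sum_(i < k) (A i - correlation a (u i)).
    rewrite -mulr_sumr exchange_big.
    under [X in _ = _ * X]eq_bigr do rewrite sumrB sumr_const card_ord -mulr_natl.
    rewrite !mulr_sumr; apply: eq_bigr => i _ /=; rewrite -/(C i).
    by field; rewrite nu gt_eqF.
  by rewrite mulr_sumr; apply: ler_sum => a _; exact: gap.
(* The potential enters with a favourable sign on both sides. *)
have final : g * (k%:R / rmax - L) <= 4 / (rmin * n%:R) * L.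
  apply: (@le_trans _ _ (g * \sum_(i < k) (n%:R^-1 * C i))).
    apply: ler_wpM2l => //.
    have -> : k%:R / rmax = \sum_(i < k) rmax^-1 by rewrite sumr_const card_ord mulr_natl.
    rewrite -sumrB; apply: ler_sum => i _.
    by have := A1 i; have := V0 i; have := energy i; lra.
  apply: le_trans gapsum _; apply: ler_wpM2l.
    by rewrite divr_ge0 // mulr_ge0 // ltW.
  apply: ler_sum => i _.
  by have := V0 i; have := energy i; lra.
have := ler_wpM2l (ltW (divr_gt0 rmin0 k0)) final.
rewrite -/rmin -/rmax -/g -/L natrM.
have -> : rmin / k%:R * (g * (k%:R / rmax - L)) = g * (rmin / rmax - rmin / k%:R * L).
  by field; rewrite !gt_eqF.
have -> : rmin / k%:R * (4 / (rmin * n%:R) * L) = 4 / (n%:R * k%:R) * L.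
  by field; rewrite nu !gt_eqF.
by [].
Qed.
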